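(* Let $\mathcal{F},\mathcal{G}$ be regular thin families. If $o(\mathcal{F})\le o(\mathcal{G})$, then for every infinite $M\subseteq\mathbb{N}$ there exist an infinite $N\subseteq\mathbb{N}$ and a map $\varphi:\mathcal{G}\upharpoonright N\to\mathcal{F}\upharpoonright M$ such that for every $l\in\mathbb{N}$ and every plegma tuple $(s_i)_{i=1}^l$ of elements of $\mathcal{G}\upharpoonright N$, the tuple $(\varphi(s_i))_{i=1}^l$ is a plegma tuple of elements of $\mathcal{F}\upharpoonright M$.
   Context: $\mathbb{N}=\{1,2,\dots\}$. For a finite set $s\subset\mathbb{N}$, $|s|$ is its cardinality and $s(k)$ its $k$-th element in increasing order; $t\sqsubseteq s$ (resp. $t\sqsubset s$) means that $t$ is an initial segment (resp. proper initial segment) of $s$. For a family $\mathcal{F}$ of finite subsets of $\mathbb{N}$ let $\widehat{\mathcal{F}}=\{t:\exists s\in\mathcal{F},\ t\sqsubseteq s\}$ and $\mathcal{F}\upharpoonright M=\{s\in\mathcal{F}:s\subseteq M\}$. $\mathcal{F}$ is thin if no element of it is a proper initial segment of another. A family is regular if it is hereditary (closed under subsets), spreading (if $\{n_1<\dots<n_k\}$ is in it, $m_1<\dots<m_k$ and $n_i\le m_i$ for all $i$, then $\{m_1,\dots,m_k\}$ is in it) and compact (the characteristic functions of its members form a closed subset of $\{0,1\}^{\mathbb{N}}$). $\mathcal{F}$ is regular thin if it is thin and $\widehat{\mathcal{F}}$ is regular. The order $o(\mathcal{F})$ of a regular thin family is the rank of the well-founded tree $(\widehat{\mathcal{F}},\sqsubseteq)$: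 maximal elements of $\widehat{\mathcal{F}}$ have rank $0$, the rank of $s\in\widehat{\mathcal{F}}$ is $\sup\{\mathrm{rank}(t)+1: t\in\widehat{\mathcal{F}},\ s\sqsubset t\}$, and $o(\mathcal{F})$ is the rank of $\emptyset$ (by convention the empty family has order $-1$). A tuple $(s_1,\dots,s_l)$ of nonempty finite subsets of $\mathbb{N}$ is plegma if (i) $s_i(k)<s_j(k)$ whenever $1\le i<j\le l$ and $k\le\min(|s_i|,|s_j|)$, and (ii) $s_i(k)<s_j(k+1)$ for all $i,j\in\{1,\dots,l\}$ and $k\le\min(|s_i|,|s_j|-1)$.
   Formalization: Assumes F is nonempty whenever G is, and that F has a nonempty member whenever G has one; otherwise (F empty with G nonempty, or F={∅} with G having a nonempty member) no such map φ exists and the claim is false. *)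

(* Defs.v *)
From mathcomp Require Import all_boot all_order finmap.
From mathcomp Require Import all_classical all_reals all_analysis.

Set Implicit Arguments.
Unset Strict Implicit.
Unset Printing Implicit Defensive.

Local Open Scope classical_set_scope.
Local Open Scope nat_scope.

(* The paper's N is {1, 2, ...}: [Npos] carves it out of [nat], and families
   are sets of finite sets of naturals all of whose members lie in [Npos]. *)
Definition Npos : set nat := [set n | 0 < n].

Definition fin_family := set {fset nat}.

Definition elts (s : {fset nat}) : seq nat := sort leq s.

(* Elements are counted from 0: [elt s k] is s(k+1) in 1-based notation, and is
   meaningful only for [k < #|` s|]. *)
Definition elt (s : {fset nat}) (k : nat) : nat := nth 0 (elts s) k.

Definition init_seg (t s : {fset nat}) : Prop := prefix (elts t) (elts s).
Definition proper_init_seg (t s : {fset nat}) : Prop := init_seg t s /\ t <> s.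

Definition hat (F : fin_family) : fin_family :=
  [set t | exists s, F s /\ init_seg t s].

Definition restr (F : fin_family) (M : set nat) : fin_family :=
  [set s | F s /\ [set` s] `<=` M].

Definition thin (F : fin_family) : Prop :=
  forall s t, F s -> F t -> ~ proper_init_seg s t.

Definition hereditary (F : fin_family) : Prop :=
  forall s t, F s -> (t `<=` s)%fset -> F t.

Definition spreading (F : fin_family) : Prop :=
  forall s t, F s -> #|` t| = #|` s| ->
    (forall k, k < #|` s| -> elt s k <= elt t k) -> F t.

(* The coordinate 0 of {0,1}^nat is identically false on families living on
   [Npos], hence harmless. *)
Definition char_fun (s : {fset nat}) : cantor_space := fun n : nat => n \in s.

Definition compact_family (F : fin_family) : Prop := closed (char_fun @` F).

Definition regular_family (F : fin_family) : Prop :=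
  [/\ hereditary F, spreading F & compact_family F].

Definition regular_thin (F : fin_family) : Prop :=
  [/\ (forall s, F s -> [set` s] `<=` Npos), thin F & regular_family (hat F)].

(* Ordinals as well-founded trees: [osup f] denotes sup_i (f i + 1). Equality of
   ordinals is [ole] in both directions, not Leibniz equality. *)
Inductive ord : Type := osup (A : Type) (f : A -> ord).

(* sup_i (f i + 1) <= sup_j (g j + 1) iff every f i is < sup_j (g j + 1), i.e.
   is <= some g j. *)
Fixpoint ole (a b : ord) {struct a} : Prop :=
  match a, b with
  | osup A f, osup B g => forall i : A, exists j : B, ole (f i) (g j)
  end.

Definition osucc (a : ord) : ord := osup (fun _ : unit => a).

Lemma ole_refl a : ole a a.
Proof. by elim: a => A f IH i; exists i; exact: IH. Qed.

Lemma ole_trans a b c : ole a b -> ole b c -> ole a c.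
Proof.
elim: a b c => A f IH [B g] [C h] /= fg gh i.
have [j fgj] := fg i; have [k ghk] := gh j.
by exists k; exact: IH fgj ghk.
Qed.

Lemma osup_lub A (f : A -> ord) b :
  ole (osup f) b <-> forall i, ole (osucc (f i)) b.
Proof. by case: b => B g /=; split=> [H i _|H i]; [exact: H | exact: (H i tt)]. Qed.

Lemma ole_total a b : ole a b \/ ole (osucc b) a.
Proof.
elim: a b => A f IH [B g].
have [H|/existsNP[i Hi]] :=
  pselect (forall i, exists j, ole (f i) (g j)); first by left.
right=> _; exists i; apply/osup_lub => j.
by case: (IH i (g j)) => // fg; case: Hi; exists j.
Qed.

(* [t] comes after [s] in the tree; the recursion defining the rank goes from
   nodes to their proper extensions. *)
Definition extends (F : fin_family) (t s : {fset nat}) : Prop :=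
  hat F t /\ proper_init_seg s t.

Fixpoint acc_rank F s (h : Acc (extends F) s) {struct h} : ord :=
  osup (fun t : {t | extends F t s} => acc_rank (Acc_inv h (proj2_sig t))).

(* The second branch is never taken for regular thin families, see [rankE]. *)
Definition rank (F : fin_family) (s : {fset nat}) : ord :=
  match pselect (Acc (extends F) s) with
  | left h => acc_rank h
  | right _ => osup (fun e : False => match e with end)
  end.

(* [None] stands for the conventional order -1 of the empty family. *)
Definition tree_order (F : fin_family) : option ord :=
  if pselect (F !=set0) then Some (rank F fset0) else None.

Definition order_le (x y : option ord) : Prop :=
  match x, y with
  | None, _ => True
  | Some _, None => False
  | Some a, Some b => ole a b
  end.

Lemma size_elts s : size (elts s) = #|` s|.
Proof. by rewrite size_sort. Qed.

Lemma mem_elts s n : (n \in elts s) = (n \in s).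
Proof. by rewrite mem_sort. Qed.

Lemma elts_inj : injective elts.
Proof. by move=> s t st; apply/fsetP=> n; rewrite -!mem_elts st. Qed.

Lemma init_seg_sub t s : init_seg t s -> (t `<=` s)%fset.
Proof.
move=> /prefixP[u su]; apply/fsubsetP=> n.
by rewrite -!mem_elts su mem_cat => ->.
Qed.

Lemma proper_init_seg_card t s : proper_init_seg t s -> #|` t| < #|` s|.
Proof.
move=> [/init_seg_sub ts neq]; apply: fproper_ltn_card.
by rewrite fproperEneq ts andbT; apply/eqP.
Qed.

(* An infinite branch of the tree would have as pointwise limit the
   characteristic function of an infinite set. *)
Lemma extends_wf F : compact_family (hat F) -> well_founded (extends F).
Proof.
move=> cF s0; apply: contrapT => nAcc0.
pose T := {s | ~ Acc (extends F) s}.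
have step (s : T) : {t : T | extends F (sval t) (sval s)}.
  apply: cid; apply: contrapT => H; apply: (svalP s); constructor=> t st.
  apply: contrapT => nt; apply: H; by exists (exist _ t nt).
pose u n : {fset nat} :=
  sval (iter n (fun s => sval (step s)) (exist _ s0 nAcc0 : T)).
have uS n : extends F (u n.+1) (u n) by rewrite /u iterS; case: (step _).
have usub m n : m <= n -> (u m `<=` u n)%fset.
  elim: n => [|n IH]; first by rewrite leqn0 => /eqP ->.
  rewrite leq_eqVlt => /predU1P[-> //|/IH mn].
  by apply: (fsubset_trans mn); apply: init_seg_sub; case: (uS n) => _ [].
have ucard n : n <= #|` u n|.
  elim: n => // n IH; apply: (leq_ltn_trans IH).
  by apply: proper_init_seg_card; case: (uS n).
pose x : cantor_space := fun n => `[< exists k, n \in u k >].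
have ux : (fun k => char_fun (u k.+1)) @ \oo --> x.
  apply/pointwise_cvgP => i.
  suff ev : \forall k \near \oo, char_fun (u k.+1) i = x i.
    move=> A /nbhs_singleton Axi; rewrite !nbhs_filterE.
    by apply: filterS ev => k; rewrite /= => ->.
  have [[k ik]|nk] := pselect (exists k, i \in u k).
    exists k => // n /= kn; rewrite /char_fun /x asboolT; last by exists k.
    by apply: (fsubsetP (usub k n.+1 _)) => //; exact: leqW.
  apply: nearW => n; rewrite /char_fun /x asboolF //.
  by apply/negbTE/negP => iun; apply: nk; exists n.+1.
have [t Ft tx] : (char_fun @` hat F) x.
  apply: (@closed_cvg _ _ \oo _ (fun k => char_fun (u k.+1)) _ cF _ x ux).
  apply: nearW => n.
  by exists (u n.+1) => //; case: (uS n).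
have ut k : (u k `<=` t)%fset.
  apply/fsubsetP=> n nk; rewrite -[n \in t]/(char_fun t n) tx.
  by apply/asboolP; exists k.
by have := fsubset_leq_card (ut #|` t|.+1); rewrite leqNgt ucard.
Qed.

Lemma rankE F s : regular_thin F ->
  rank F s = osup (fun t : {t | extends F t s} => rank F (sval t)).
Proof.
move=> [_ _ [_ _ cF]]; have wF := extends_wf cF.
rewrite /rank; case: pselect => [h|[]//]; case: h => h /=.
congr osup; apply/funext=> t; case: pselect => [k|[]//].
by congr acc_rank; exact: Prop_irrelevance.
Qed.

(* The entry of the tuple at position i is [s i]; with 0-based positions and
   elements the bounds k <= min(|s_i|, |s_j|) and k <= min(|s_i|, |s_j| - 1)
   become strict. *)
Definition plegma (l : nat) (s : 'I_l -> {fset nat}) : Prop :=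
  [/\ forall i, s i <> fset0,
      forall i j : 'I_l, i < j -> forall k, k < minn #|` s i| #|` s j| ->
        elt (s i) k < elt (s j) k
    & forall (i j : 'I_l) k, k < minn #|` s i| (#|` s j| - 1) ->
        elt (s i) k < elt (s j) k.+1].

(* Main.v *)
(* A map s |-> (initial segment of h[s]) with h : N -> M strictly increasing
   preserves plegma tuples, because the k-th element of the image is h(s(k)) and
   images are not longer than s. So it suffices to choose N and h such that h[s]
   has an initial segment in F for every s in G restricted to N. This follows
   from the invariant, for finite s in N: either h[s] has an initial segment in
   F, or h[s] is in hat F and rank_F(h[s]) <= rank_G(s); the second case is
   impossible for s in G, which is maximal in hat G. To preserve the invariant
   when the pair (n, m) with h(n) = m is added, take m so large that
   h[s] u {m} is in hat F (spreading) for all the finitely many s of the second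
   case; then rank_F(h[s] u {m}) < rank_F(h[s]) <= rank_G(s), so
   rank_F(h[s] u {m}) <= rank_G(s u {n}) for some n, and for all larger n since
   ranks grow when a set is spread out. *)
Require Import Defs.
From mathcomp Require Import all_boot all_order finmap.
From mathcomp Require Import all_classical all_reals all_analysis.

Local Open Scope classical_set_scope.
Local Open Scope nat_scope.

(** * Increasing enumerations and initial segments of finite sets *)

Lemma sorted_elts s : sorted ltn (elts s).
Proof. by rewrite ltn_sorted_uniq_leq sort_uniq fset_uniq sort_sorted. Qed.

Lemma eltsP s w : sorted ltn w -> s =i w -> elts s = w.
Proof.
move=> w_sorted sw; apply: (irr_sorted_eq ltn_trans ltnn) => //.
  exact: sorted_elts.
by move=> x; rewrite mem_elts sw.
Qed.

Lemma elts_fset_seq w : sorted ltn w -> elts [fset x in w]%fset = w.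
Proof. by move=> w_sorted; apply: eltsP => // x; rewrite in_fset_. Qed.

Lemma elts_fsetU1 m s :
  (forall x, x \in s -> x < m) -> elts (m |` s)%fset = rcons (elts s) m.
Proof.
move=> s_lt; apply: eltsP => [|x]; last by rewrite in_fset1U mem_rcons inE mem_elts.
rewrite -cats1 (sorted_pairwise ltn_trans) pairwise_cat allrel1r.
rewrite -(sorted_pairwise ltn_trans) sorted_elts !andbT.
by apply/allP => x; rewrite mem_elts; exact: s_lt.
Qed.

Lemma elts_imfset (h : nat -> nat) (s : {fset nat}) :
  {in s &, {homo h : x y / x < y}} -> elts (h @` s)%fset = map h (elts s).
Proof.
move=> h_homo; apply: eltsP => [|x].
  apply: (homo_sorted_in h_homo) (sorted_elts s).
  by apply/allP => x; rewrite mem_elts.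
apply/imfsetP/mapP => -[y /= ys ->]; exists y => //; first by rewrite mem_elts.
by rewrite -mem_elts.
Qed.

Lemma init_seg_elt {t s k} : init_seg t s -> k < #|` t| -> elt t k = elt s k.
Proof. by move=> /prefixP[w sw] kt; rewrite /elt sw nth_cat size_elts kt. Qed.

Lemma elt_mem {s k} : k < #|` s| -> elt s k \in s.
Proof. by move=> ks; rewrite -mem_elts /elt mem_nth // size_elts. Qed.

Lemma init_seg0 s : init_seg fset0 s.
Proof.
rewrite /init_seg (_ : elts fset0 = [::]).
  exact: prefix0s.
by apply: size0nil; rewrite size_elts cardfs0.
Qed.

Lemma init_seg_trans {r t s} : init_seg r t -> init_seg t s -> init_seg r s.
Proof. exact: prefix_trans. Qed.

Lemma proper_init_segU1 {m s} :
  (forall x, x \in s -> x < m) -> proper_init_seg s (m |` s)%fset.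
Proof.
move=> s_lt; split; first by rewrite /init_seg elts_fsetU1 // -cats1 prefix_prefix.
move=> e; suff /s_lt : m \in s by rewrite ltnn.
by rewrite e fset1U1.
Qed.

Lemma elt_fsetU1 m s k : (forall x, x \in s -> x < m) -> k < #|` (m |` s)%fset| ->
  elt (m |` s)%fset k = if k < #|` s| then elt s k else m.
Proof.
move=> s_lt; rewrite -size_elts /elt elts_fsetU1 // size_rcons size_elts nth_rcons.
rewrite size_elts ltnS leq_eqVlt.
by case: ifP => //= _; rewrite orbF => ->.
Qed.

Lemma card_fsetU1_ub {m s} :
  (forall x, x \in s -> x < m) -> #|` (m |` s)%fset| = #|` s|.+1.
Proof. by move=> s_lt; rewrite -!size_elts elts_fsetU1 // size_rcons. Qed.

(** * Comparison of ranks *)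

(* Tails of extensions of s are shifted far to the right to become tails of
   extensions of t. *)
Lemma rank_spread F s t : regular_thin F -> #|` t| <= #|` s| ->
  (forall k, k < #|` t| -> elt s k <= elt t k) -> ole (rank F s) (rank F t).
Proof.
move=> F_rt; have [_ _ [_ F_spread /extends_wf F_wf]] := F_rt.
elim/(well_founded_ind F_wf): s t => s IH t card_ts le_st.
rewrite (rankE s F_rt) (rankE t F_rt) /= => -[u su].
have [Fu [su_init _]] := su.
have card_su := proper_init_seg_card su.2.
have card_tu : #|` t| < #|` u| := leq_ltn_trans card_ts card_su.
(* Shifting by [c] puts the tail of [u] above all of [t]. The resulting [v] extends [t] and
   dominates [u] elementwise, so the induction hypothesis compares [u] with [v]. *)
pose c := (\max_(x <- elts t) x).+1.
have t_lt_c x : x \in elts t -> x < c.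
  by move=> xt; rewrite ltnS; exact: leq_bigmax_seq.
pose w := elts t ++ map (addn c) (drop #|` t| (elts u)).
have w_sorted : sorted ltn w.
  rewrite (sorted_pairwise ltn_trans) pairwise_cat.
  apply/and3P; split.
  - apply/allrelP => x y xt /mapP[z _ ->].
    by rewrite (leq_trans (t_lt_c _ xt)) // leq_addr.
  - by rewrite -(sorted_pairwise ltn_trans) sorted_elts.
  - rewrite pairwise_map -(sorted_pairwise); last by move=> y x z; exact: ltn_trans.
    rewrite (eq_sorted (e' := ltn)); last by move=> x y /=; rewrite ltn_add2l.
    by rewrite drop_sorted ?sorted_elts.
pose v := [fset x in w]%fset.
have elts_v : elts v = w by exact: elts_fset_seq.
have card_v : #|` v| = #|` u|.
  by rewrite -size_elts elts_v size_cat size_map size_drop !size_elts subnKC // ltnW.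
have le_uv k : k < #|` u| -> elt u k <= elt v k.
  move=> ku; rewrite {2}/elt elts_v nth_cat size_elts.
  case: ltnP => [kt|tk].
    by rewrite -(init_seg_elt su_init) ?(leq_trans kt) //; exact: le_st.
  rewrite (nth_map 0) ?size_drop ?size_elts ?ltn_sub2r // nth_drop subnKC //.
  exact: leq_addl.
have tv : extends F v t.
  split; first by apply: F_spread Fu _ _ => //; rewrite card_v.
  split; first by rewrite /init_seg elts_v prefix_prefix.
  by move=> e; rewrite e card_v ltnn in card_tu.
by exists (exist _ v tv) => /=; apply: IH; rewrite ?card_v //.
Qed.

Lemma proper_init_seg_next {s t} : proper_init_seg s t ->
  exists a, (forall x, x \in s -> x < a) /\ init_seg (a |` s)%fset t.
Proof.
move=> [/prefixP[[|a w] tE] neq].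
  by case: neq; apply: elts_inj; rewrite tE cats0.
have s_lt x : x \in s -> x < a.
  move=> xs; have := sorted_elts t; rewrite tE (sorted_pairwise ltn_trans).
  rewrite pairwise_cat => /andP[/allrelP + _]; apply; last exact: mem_head.
  by rewrite mem_elts.
by exists a; split=> //; rewrite /init_seg elts_fsetU1 // tE -cat_rcons prefix_prefix.
Qed.

(** As [B] is continued in some member of [F], spreading makes every large [m] admissible. Adding
    [m] strictly lowers the rank, so some proper extension [t] of [A] still has at least that rank,
    and so does [A] with any [n] past the next element of [t]. The threshold for [n] depends on
    [m]. *)
Lemma rank_step {F G A B} : regular_thin F -> regular_thin G ->
  hat F B -> ~ F B -> ole (rank F B) (rank G A) ->
  \forall m \near \oo, hat F (m |` B)%fset /\
    \forall n \near \oo, ole (rank F (m |` B)%fset) (rank G (n |` A)%fset).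
Proof.
move=> F_rt G_rt [f [Ff Bf]] nFB rank_le.
have /proper_init_seg_next[a [B_lt_a Ba_f]] : proper_init_seg B f.
  by split=> // Bf_eq; rewrite Bf_eq in nFB.
exists a => // m /= am.
have B_lt_m x : x \in B -> x < m by move=> /B_lt_a xa; exact: leq_trans am.
have FBm : hat F (m |` B)%fset.
  have [_ _ [_ F_spread _]] := F_rt.
  apply: (F_spread (a |` B)%fset); first by exists f.
    by rewrite !card_fsetU1_ub.
  move=> k k_lt; have k_lt' : k < #|` (m |` B)%fset|.
    by move: k_lt; rewrite !card_fsetU1_ub.
  by rewrite !elt_fsetU1 //; case: ifP.
split=> //; rewrite (rankE B F_rt) (rankE A G_rt) in rank_le.
have [[t At] /= rank_Bm_t] :=
  rank_le (exist _ (m |` B)%fset (conj FBm (proper_init_segU1 B_lt_m))).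
have [b [A_lt_b Ab_t]] := proper_init_seg_next At.2.
exists b => // n /= bn.
have A_lt_n x : x \in A -> x < n by move=> /A_lt_b xb; exact: leq_trans bn.
apply: (ole_trans rank_Bm_t); apply: rank_spread => //.
  rewrite card_fsetU1_ub // -(card_fsetU1_ub A_lt_b).
  exact: fsubset_leq_card (init_seg_sub Ab_t).
move=> k k_lt; have k_lt' : k < #|` (b |` A)%fset|.
  by move: k_lt; rewrite !card_fsetU1_ub.
by rewrite -(init_seg_elt Ab_t) // !elt_fsetU1 //; case: ifP.
Qed.

(** * Recursive choice under finitely many eventual conditions *)

Lemma prefix_dependent_choice {T} {P : seq T -> T -> Prop} :
  (forall w, exists x, P w x) -> exists p : nat -> T, forall k, P (mkseq p k) (p k).
Proof.
move=> /choice[next nextP].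
pose w_ k := iter k (fun w => rcons w (next w)) [::].
exists (fun k => next (w_ k)) => k.
suff -> : mkseq (fun k => next (w_ k)) k = w_ k by [].
by elim: k => // k IH; rewrite mkseqS IH.
Qed.

Lemma infinite_set_near {M : set nat} {P : nat -> Prop} :
  infinite_set M -> (\forall m \near \oo, P m) -> exists m, M m /\ P m.
Proof.
move=> M_inf [k _ kP]; apply: contrapT => nMP; apply: M_inf.
apply: sub_finite_set (finite_II k) => m Mm /=.
rewrite ltnNge; apply/negP => km; apply: nMP; exists m.
by split=> //; exact: kP.
Qed.

(** A finite set has finitely many subsets, so one threshold serves them all; this lets a single new
    value suit every index set. *)
Lemma near_fpowerset (D : {fset nat}) (P : {fset nat} -> nat -> Prop) :
  (forall V, (V `<=` D)%fset -> \forall n \near \oo, P V n) ->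
  \forall n \near \oo, forall V, (V `<=` D)%fset -> P V n.
Proof.
move=> PD; have : \forall n \near \oo, (\bigcap_(V in [set` fpowerset D]) P V) n.
  by apply: filter_bigI => V; rewrite fpowersetE; exact: PD.
by apply: filterS => n Pn V VD; apply: Pn; rewrite /= fpowersetE.
Qed.

(** * Simultaneous construction of N and h *)

(* The values of [nu] are the elements of N, and h maps [nu i] to [mu i]; finite
   subsets of N are images under [nu] of sets V of indices. *)
Lemma increasing_coding {F G} {M : set nat} : regular_thin F -> regular_thin G ->
  F !=set0 -> ole (rank F fset0) (rank G fset0) -> infinite_set M ->
  exists nu mu : nat -> nat, [/\ {homo nu : i j / i < j}, {homo mu : i j / i < j},
    (forall i, 0 < nu i), (forall i, M (mu i)) &
    forall V : {fset nat}, G (nu @` V)%fset ->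
      exists t, F t /\ init_seg t (mu @` V)%fset].
Proof.
move=> F_rt G_rt [f0 Ff0] F_le_G M_inf.
(* The second case of the invariant, restricted to images that are not yet in [F] and so can still
   grow. *)
pose tame (V : {fset nat}) (nu mu : nat -> nat) :=
  let B := (mu @` V)%fset in
  [/\ hat F B, ~ F B & ole (rank F B) (rank G (nu @` V)%fset)].
(* [n] and [m] are candidates for the next values of [nu] and [mu]. *)
pose step (V : {fset nat}) (nu mu : nat -> nat) n m :=
  let B := (mu @` V)%fset in tame V nu mu ->
  hat F (m |` B)%fset /\
  ole (rank F (m |` B)%fset) (rank G (n |` nu @` V)%fset).
pose below k := [fset i in iota 0 k]%fset.
have belowE k i : (i \in below k) = (i < k) by rewrite !inE mem_iota.
(* [w] lists the pairs chosen so far. Only indices below [size w] are read, so the default [(0, 0)]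
   never appears. *)
pose P (w : seq (nat * nat)) p :=
  let nu i := (nth (0, 0) w i).1 in let mu i := (nth (0, 0) w i).2 in
  [/\ 0 < p.1, M p.2,
    forall i, i < size w -> nu i < p.1 /\ mu i < p.2 &
    forall V, (V `<=` below (size w))%fset -> step V nu mu p.1 p.2].
have Pex w : exists p, P w p.
  pose nu i := (nth (0, 0) w i).1; pose mu i := (nth (0, 0) w i).2.
  have ub (h : nat -> nat) : \forall n \near \oo, forall i, i < size w -> h i < n.
    exists (\max_(i < size w) h i).+1 => // n /= hn i iw.
    exact: leq_ltn_trans (leq_bigmax (Ordinal iw)) hn.
  (* [m] is fixed first and guarantees the rank inequality for all large [n]; [n] is chosen
     afterwards. *)
  pose Q (V : {fset nat}) m := let B := (mu @` V)%fset in
    tame V nu mu -> hat F (m |` B)%fset /\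
    \forall n \near \oo,
      ole (rank F (m |` B)%fset) (rank G (n |` nu @` V)%fset).
  have [m [Mm [mu_m Qm]]] : exists m, M m /\
      ((forall i, i < size w -> mu i < m) /\
       (forall V, (V `<=` below (size w))%fset -> Q V m)).
    apply: infinite_set_near => //; apply: filterI; first exact: ub.
    apply: near_fpowerset => V _.
    have [tV|ntV] := pselect (tame V nu mu); last first.
      by apply: nearW => ? ? /ntV.
    have [FB nFB le] := tV.
    by apply: filterS (rank_step F_rt G_rt FB nFB le) => m ? ? _.
  have [n [_ [n_gt0 [nu_n Sn]]]] : exists n, [set: nat] n /\ (0 < n /\
      ((forall i, i < size w -> nu i < n) /\
       (forall V, (V `<=` below (size w))%fset -> step V nu mu n m))).
    apply: infinite_set_near; first exact: infinite_nat.
    apply: filterI; first by exists 1.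
    apply: filterI; first exact: ub.
    apply: near_fpowerset => V /Qm QV.
    have [tV|ntV] := pselect (tame V nu mu); last first.
      by apply: nearW => ? ? /ntV.
    by have [? /filterS] := QV tV; apply => n ? ? _.
  by exists (n, m); split=> // i iw; split; [exact: nu_n|exact: mu_m].
have [p pP] := prefix_dependent_choice Pex.
pose nu i := (p i).1; pose mu i := (p i).2.
have lt_p i j : i < j -> nu i < nu j /\ mu i < mu j.
  by move=> ij; have [_ _ + _] := pP j => /(_ i); rewrite size_mkseq nth_mkseq //; apply.
have nu_homo : {homo nu : i j / i < j} by move=> i j /lt_p[].
have mu_homo : {homo mu : i j / i < j} by move=> i j /lt_p[].
have stepP k V : (V `<=` below k)%fset -> step V nu mu (nu k) (mu k).
  have [_ _ _ +] := pP k => /(_ V); rewrite size_mkseq => + Vk => /(_ Vk).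
  rewrite /step /tame.
  have -> : ((fun i => (nth (0, 0) (mkseq p k) i).1) @` V = nu @` V)%fset.
    by apply: eq_in_imfset => i /(fsubsetP Vk); rewrite belowE => ?; rewrite nth_mkseq.
  have -> // : ((fun i => (nth (0, 0) (mkseq p k) i).2) @` V = mu @` V)%fset.
  by apply: eq_in_imfset => i /(fsubsetP Vk); rewrite belowE => ?; rewrite nth_mkseq.
have invariant k V : (V `<=` below k)%fset ->
    (exists t, F t /\ init_seg t (mu @` V)%fset) \/
    hat F (mu @` V)%fset /\ ole (rank F (mu @` V)%fset) (rank G (nu @` V)%fset).
  elim: k V => [|k IH] V Vk.
    right; move: Vk; rewrite [below 0](_ : _ = fset0).
      rewrite fsubset0 => /eqP ->; rewrite !imfset0; split=> //.
      by exists f0; split=> //; exact: init_seg0.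
    by apply/fsetP => i; rewrite belowE inE.
  (* If [k] is in [V], it is the largest index, so both images of [V] arise from those of [W] by
     adding a new largest element. *)
  pose W := (V `\ k)%fset.
  have Wk : (W `<=` below k)%fset.
    apply/fsubsetP => i; rewrite in_fsetD1 => /andP[ik /(fsubsetP Vk)].
    by rewrite !belowE ltnS leq_eqVlt (negPf ik).
  have [kV|kV] := boolP (k \in V); last first.
    by rewrite -(mem_fsetD1 kV); exact: IH.
  have W_lt h : {homo h : i j / i < j} -> forall x, x \in (h @` W)%fset -> x < h k.
    move=> h_homo x /imfsetP[i /= /(fsubsetP Wk)].
    by rewrite belowE => ik ->; exact: h_homo.
  have VE : V = (k |` W)%fset by rewrite fsetD1K.
  rewrite VE !imfsetU1.
  have mu_init : init_seg (mu @` W)%fset (mu k |` mu @` W)%fset.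
    by have [] := proper_init_segU1 (W_lt _ mu_homo).
  have [[t [Ft tW]]|[FW W_le]] := IH _ Wk.
    by left; exists t; split=> //; exact: init_seg_trans tW mu_init.
  have [FB|nFB] := pselect (F (mu @` W)%fset); first by left; exists (mu @` W)%fset.
  by right; exact: stepP.
exists nu, mu; split=> //.
- by move=> i; have [] := pP i.
- by move=> i; have [] := pP i.
move=> V GV; pose k := (\max_(i <- elts V) i).+1.
have Vk : (V `<=` below k)%fset.
  apply/fsubsetP => i iV; rewrite belowE ltnS.
  by apply: leq_bigmax_seq; rewrite ?mem_elts.
have [//|[FV V_le]] := invariant _ _ Vk.
exists (mu @` V)%fset; split; last exact: prefix_refl.
apply: contrapT => nFV.
have [f [Ff Vf]] := FV.
have ext : extends F f (mu @` V)%fset.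
  split; first by exists f; split=> //; exact: prefix_refl.
  by split=> // e; rewrite e in nFV.
move: V_le; rewrite (rankE _ F_rt) (rankE _ G_rt) => /(_ (exist _ f ext)) [[t Vt] _].
have [[g [Gg tg]] Vt'] := Vt.
have [_ G_thin _] := G_rt; apply: (G_thin _ _ GV Gg).
split; first exact: init_seg_trans Vt'.1 tg.
move=> e; have := proper_init_seg_card Vt'; rewrite e ltnNge.
by rewrite fsubset_leq_card // init_seg_sub.
Qed.

(** * The map on finite sets and its action on plegma tuples *)

(* [F_nonempty] and [F_nondegenerate] only exclude F = {} and F = {fset0} in
   the cases where the conclusion is false; they hold as soon as F has a
   nonempty member, i.e. as soon as its order is at least 1. *)
Theorem theorem0p5 (F G : fin_family)
    (F_regular_thin : regular_thin F) (G_regular_thin : regular_thin G)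
    (F_le_G : order_le (tree_order F) (tree_order G))
    (F_nonempty : G !=set0 -> F !=set0)
    (F_nondegenerate :
       (exists s, G s /\ s <> fset0) -> exists s, F s /\ s <> fset0)
    (M : set nat) (M_Npos : M `<=` Npos) (M_infinite : infinite_set M) :
  exists (N : set nat) (phi : {fset nat} -> {fset nat}),
    [/\ N `<=` Npos, infinite_set N,
        set_fun (restr G N) (restr F M) phi
      & forall (l : nat) (s : 'I_l -> {fset nat}), 0 < l ->
          (forall i, restr G N (s i)) -> plegma s ->
          plegma (fun i => phi (s i))].
Proof.
have [G0|nG0] := pselect (G !=set0); last first.
  exists M, id; split=> //.
  by move=> s [Gs _]; case: nG0; exists s.
have F0 := F_nonempty G0.
have rank_le : ole (rank F fset0) (rank G fset0).
  by move: F_le_G; rewrite /tree_order; case: pselect => // ?; case: pselect.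
have [nu [mu [nu_homo mu_homo nu_gt0 Mmu nuP]]] :=
  increasing_coding F_regular_thin G_regular_thin F0 rank_le M_infinite.
have nu_mono := leqW_mono (leq_mono nu_homo).
pose N := range nu.
have [g nuK] : exists g, cancel nu g.
  have [|g gP] := @choice _ _ (fun x i => N x -> nu i = x).
    move=> x; have [[i _ <-]|nx] := pselect (N x); first by exists i.
    by exists 0.
  by exists g => i; apply: (incn_inj (leq_mono nu_homo)); apply: gP; exists i.
have nugK x : N x -> nu (g x) = x by move=> [i _ <-]; rewrite nuK.
pose h := mu \o g.
have h_homo x y : N x -> N y -> x < y -> h x < h y.
  by move=> [i _ <-] [j _ <-]; rewrite nu_mono /h /= !nuK; exact: mu_homo.
have [phi phiP] : exists phi : {fset nat} -> {fset nat}, forall s,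
    restr G N s -> F (phi s) /\ init_seg (phi s) (h @` s)%fset.
  suff /choice[phi phiP] : forall s, exists t, restr G N s ->
      F t /\ init_seg t (h @` s)%fset by exists phi.
  move=> s; have [[Gs sN]|ns] := pselect (restr G N s); last by exists fset0.
  (* [g] decodes a subset of [N] into its index set, to which [nuP] applies. *)
  have sE : (nu @` (g @` s) = s)%fset.
    apply/fsetP => x; apply/imfsetP/idP => [[_ /imfsetP[y /= ys ->] ->]|xs].
      by rewrite nugK //; exact: sN.
    by exists (g x); [exact: in_imfset|rewrite nugK //; exact: sN].
  have [t [Ft ts]] := nuP (g @` s)%fset (eq_ind_r G Gs sE).
  by exists t; rewrite /h imfset_comp.
have elts_h s : restr G N s -> elts (h @` s)%fset = map h (elts s).
  move=> [_ sN]; apply: elts_imfset => x y /sN Nx /sN Ny; exact: h_homo.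
have card_phi s : restr G N s -> #|` phi s| <= #|` s|.
  move=> GNs; have [_ /init_seg_sub/fsubset_leq_card] := phiP _ GNs.
  by rewrite -[X in _ <= X -> _]size_elts elts_h // size_map size_elts.
have elt_phi s k : restr G N s -> k < #|` phi s| -> elt (phi s) k = h (elt s k).
  move=> GNs ks; have [_ /init_seg_elt ->//] := phiP _ GNs.
  rewrite /elt elts_h // (nth_map 0) // size_elts.
  exact: leq_trans ks (card_phi _ GNs).
(* Both plegma inequalities are instances of this: [j = i] for the first, [j = i.+1] for the
   second. *)
have phi_lt s t i j : restr G N s -> restr G N t ->
    i < #|` phi s| -> j < #|` phi t| -> elt s i < elt t j ->
    elt (phi s) i < elt (phi t) j.
  move=> GNs GNt i_lt j_lt; rewrite !elt_phi //.
  apply: h_homo; [apply: GNs.2|apply: GNt.2] => /=; apply: elt_mem.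
    exact: leq_trans i_lt (card_phi _ GNs).
  exact: leq_trans j_lt (card_phi _ GNt).
exists N, phi; split.
- by move=> _ [i _ <-]; exact: nu_gt0.
- move=> /(finite_image g); apply: sub_infinite_set infinite_nat => i _.
  by exists (nu i); [exists i|exact: nuK].
- move=> s GNs; have [Fs sh] := phiP _ GNs; split=> // x /= /(fsubsetP (init_seg_sub sh)).
  by move=> /imfsetP[y _ ->]; exact: Mmu.
move=> l s l_gt0 GNs [s_neq0 s_lt s_ltS]; split=> [i phi0|i j ij k|i j k].
(* An empty image would put [fset0] in [F], which thinness forbids beside a nonempty member. *)
- have [t [Ft t_neq0]] : exists t, F t /\ t <> fset0.
    by apply: F_nondegenerate; exists (s i); split; [exact: (GNs i).1|].
  have [_ F_thin _] := F_regular_thin.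
  apply: (F_thin fset0 t) => //; first by rewrite -phi0; have [] := phiP _ (GNs i).
  by split; [exact: init_seg0|exact: nesym].
- rewrite leq_min => /andP[ki kj]; apply: phi_lt => //; apply: s_lt => //.
  by rewrite leq_min !(leq_trans _ (card_phi _ (GNs _))).
- rewrite leq_min ltn_subRL add1n => /andP[ki kj]; apply: phi_lt => //; apply: s_ltS.
  by rewrite leq_min ltn_subRL add1n !(leq_trans _ (card_phi _ (GNs _))).
Qed.
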